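(* Let $\alpha\in(0,1)$. Assume that $(X_i,\mathcal{F}_i)_{i\ge1}$ is a sequence of supermartingale differences satisfying $$\sup_{i\ge 1}E\exp\{(X_i^+)^{\frac{\alpha}{1-\alpha}}\}\le C_1$$ for some constant $C_1\in(0,\infty)$. Let $S_k=\sum_{i=1}^kX_i$ and $\langle S\rangle_k=\sum_{i=1}^kE(X_i^2|\mathcal{F}_{i-1})$. Then, for all $x,v>0$ and all integers $n\ge1$, $$P\big(S_k\ge x\ \text{and}\ \langle S\rangle_k\le v^2\ \text{for some}\ k\in[1,n]\big)\le\exp\left\{-\frac{x^2}{2\left(v^2+\frac13x^{2-\alpha}\right)}\right\}+nC_1\exp\{-x^{\alpha}\}.$$
   Context: A sequence of supermartingale differences $(X_i,\mathcal{F}_i)_{i\ge1}$ is a sequence of integrable real random variables on a probability space with a filtration $\mathcal{F}_0\subseteq\mathcal{F}_1\subseteq\mathcal{F}_2\subseteq\cdots$ such that each $X_i$ is $\mathcal{F}_i$-measurable and $E(X_i|\mathcal{F}_{i-1})\le0$ almost surely for all $i\ge1$; $\mathcal{F}_0$ is not required to be trivial. Notation: $X_i^+=\max\{X_i,0\}$; ''$k\in[1,n]$'' refers to integers $k$ with $1\le k\le n$. *)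

(* Defs.v *)
From HB Require Import structures.
From mathcomp Require Import all_boot all_order all_algebra.
From mathcomp Require Import all_classical all_reals all_analysis measurable_realfun.
Set Implicit Arguments.
Unset Strict Implicit.
Unset Printing Implicit Defensive.
Import Order.TTheory GRing.Theory Num.Theory.
Import numFieldNormedType.Exports.
Local Open Scope classical_set_scope.
Local Open Scope ring_scope.

Definition filtration d (T : measurableType d) (F : nat -> set (set T)) : Prop :=
  [/\ forall i, sigma_algebra [set: T] (F i),
      forall i, F i `<=` measurable &
      forall i, F i `<=` F i.+1].

(* When [G] is a sigma-algebra, [g_sigma_algebraType G] is [T] equipped with
   [G] itself as its measurable sets. *)
Definition measurable_wrt d (T : measurableType d) d' (U : measurableType d')
    (G : set (set T)) (f : T -> U) : Prop :=
  measurable_fun [set: g_sigma_algebraType G] (f : g_sigma_algebraType G -> U).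

(* [g] is a version of the conditional expectation E(f | G). Meant for
   [f] integrable or [f] nonnegative; in the latter case [f] need not be
   integrable, and [g] may take the value [+oo]. *)
Definition is_cond_exp d (T : measurableType d) (R : realType)
    (P : probability T R) (G : set (set T)) (f g : T -> \bar R) : Prop :=
  measurable_wrt G g /\
  forall A, G A -> (\int[P]_(w in A) g w = \int[P]_(w in A) f w)%E.

(* The sequence is indexed by [i >= 1]; the value [X 0] is irrelevant. *)
Definition supermartingale_differences d (T : measurableType d) (R : realType)
    (P : probability T R) (F : nat -> set (set T)) (X : nat -> T -> R) : Prop :=
  filtration F /\
  forall i, (1 <= i)%N ->
    [/\ measurable_wrt (F i) (X i),
        P.-integrable [set: T] (EFin \o X i) &
        exists Y : T -> \bar R,
          is_cond_exp P (F i.-1) (EFin \o X i) Y /\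
          {ae P, forall w, (Y w <= 0)%E}].

(* Main.v *)
Require Import Defs.
From HB Require Import structures.
From mathcomp Require Import all_boot all_order all_algebra ring lra.
From mathcomp Require Import all_classical all_reals all_analysis measurable_realfun.
Import Order.TTheory GRing.Theory Num.Theory.
Import numFieldNormedType.Exports.

(** The differences need not have exponential moments, so they are first cut at
the level y = x ^ (1 - alpha).  With p = alpha / (1 - alpha) one has
y ^ p = x ^ alpha, so Markov's inequality for exp((X_i^+) ^ p) bounds
P(X_i > y) by C1 exp(- x ^ alpha) ([exp_moment_tail]); the union bound over the
n indices gives the second term of the estimate.

When every X_i is at most y, the sums do not change if X_i is replaced by
[truncate y (X_i)], and for these bounded differences Freedman's inequality
holds with x y = x ^ (2 - alpha) in the denominator ([Freedman_truncated]).
Setting to 0 the values above y only decreases X_i and X_i ^ 2, so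
exp(lam * truncate y r) <= 1 + lam r + g r ^ 2 for every real r, where
g = lam ^ 2 / (2 (1 - lam y / 3)) ([expR_truncate_le]).  Conditionally on
F_(i-1) the linear term is nonpositive on average, so

  M_k = exp (lam * sum_(i <= k) truncate y X_i - g * sum_(i <= k) V_i^+)

is a nonnegative supermartingale ([exp_process_supermartingale]).  On the
event of interest some M_k with k <= n reaches exp(lam x - g v ^ 2), and the
maximal inequality for nonnegative supermartingales bounds the probability of
this by exp(- lam x + g v ^ 2).  The choice lam = x / (v ^ 2 + x y / 3) yields
the exponent of the statement.

Conditional expectations only enter through integrals over the sets of the
sub-sigma-algebra.  An inequality between such integrals extends to any
nonnegative weight measurable for that sub-sigma-algebra
([le_integral_mul_wrt]); with the weight M_k exp(- g V_(k+1)^+) 1_D this is the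
supermartingale property.  All the integrands are nonnegative extended real
functions, so infinite values of the conditional variances cause no trouble. *)

Set Implicit Arguments.
Unset Strict Implicit.
Unset Printing Implicit Defensive.
Local Open Scope classical_set_scope.
Local Open Scope ring_scope.

(** * An exponential inequality *)

(** The sign condition on [c] is all that is remembered of the fact that [c]
lies between [0] and [x]; it makes one statement cover both signs of [x]. *)
Lemma sign_MVT (R : realType) (f df : R -> R) (x : R) :
  (forall t : R, is_derive t 1 f (df t)) ->
  exists2 c, 0 <= c * x & f x - f 0 = df c * x.
Proof.
move=> fdf.
have fcont : continuous f.
  move=> t; apply/differentiable_continuous/derivable1_diffP.
  by have [] := fdf t.
case: (ltgtP 0 x) => [x0|x0|<-].
- have [|c cx ->] := @MVT R f df 0 x x0 (fun t _ => fdf t).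
    exact: continuous_subspaceT.
  exists c; last by rewrite subr0.
  by move: cx; rewrite in_itv/= => /andP[/ltW c0 _]; rewrite mulr_ge0// ltW.
- have [|c cx E] := @MVT R f df x 0 x0 (fun t _ => fdf t).
    exact: continuous_subspaceT.
  exists c; last by rewrite -opprB E sub0r mulrN opprK.
  by move: cx; rewrite in_itv/= => /andP[_ /ltW c0]; rewrite mulr_le0// ltW.
- by exists 0; rewrite ?mulr0 ?subrr.
Qed.

(** It is enough to treat [c = u], where the claim says that
[f u = 3/2 u^2 - (3 - u)(e^u - 1 - u)] is nonnegative.  Its derivative
[h u = (u - 2) e^u + 2 + u] vanishes at 0 and is nondecreasing, because
[h' u = (u - 1) e^u + 1] and [1 - u <= e^(- u)]; so [f] has its minimum 0 at
0. *)
Lemma expR_Bernstein (R : realType) (u c : R) : u <= c -> c < 3 ->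
  expR u <= 1 + u + u ^+ 2 / (2 * (1 - c / 3)).
Proof.
move=> uc c3.
pose h (t : R) := (t - 2) * expR t + 2 + t.
pose f (t : R) := 3 / 2 * t ^+ 2 - (3 - t) * (expR t - 1 - t).
have dh (t : R) : is_derive t 1 h ((t - 1) * expR t + 1).
  rewrite /h; apply: is_derive_eq.
  by rewrite /GRing.scale /=; ring.
have df (t : R) : is_derive t 1 f (h t).
  rewrite /f; apply: is_derive_eq.
  by rewrite /h /GRing.scale /=; field.
have h_sign (t : R) : 0 <= h t * t.
  have [s _] := sign_MVT t dh.
  have -> : h 0 = 0 by rewrite /h expR0; ring.
  rewrite subr0 => ->; rewrite -mulrA mulr_ge0 ?sqr_ge0//.
  have : 1 - s <= expR (- s) by exact: expR_ge1Dx.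
  rewrite -(ler_pM2r (expR_gt0 s)) -expRD addNr expR0; lra.
have f_ge0 : 0 <= f u.
  have [s su] := sign_MVT u df.
  have -> : f 0 = 0 by rewrite /f expR0; ring.
  rewrite subr0 => ->.
  have := h_sign s; have [->|s0] := eqVneq s 0.
    by rewrite /h expR0; lra.
  move=> hs; have s2 : 0 < s ^+ 2 by rewrite exprn_even_gt0.
  rewrite -(pmulr_lge0 _ s2) (_ : h s * u * s ^+ 2 = (h s * s) * (s * u)).
    exact: mulr_ge0.
  by ring.
have u3 : 0 < 3 - u by lra.
have : expR u <= 1 + u + u ^+ 2 / (2 * (1 - u / 3)).
  rewrite -(ler_pM2r u3).
  rewrite (_ : (1 + u + u ^+ 2 / (2 * (1 - u / 3))) * _ =
    (1 + u) * (3 - u) + 3 / 2 * u ^+ 2); last by field; lra.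
  by move: f_ge0; rewrite /f; lra.
move=> /le_trans; apply; rewrite lerD2l ler_wpM2l ?sqr_ge0//.
by rewrite lef_pV2 ?posrE; lra.
Qed.

(** * Measurability with respect to a sub-sigma-algebra *)

Section sub_sigma_algebra.
Context d (T : measurableType d) (G : set (set T)).
Hypothesis sG : sigma_algebra [set: T] G.

Lemma measurable_subalgebraE :
  measurable = G :> set (set (g_sigma_algebraType G)).
Proof. exact: sigma_algebra_id. Qed.

Lemma measurable_wrt_preimage d' (U : measurableType d') (f : T -> U) :
  measurable_wrt G f -> forall B, measurable B -> G (f @^-1` B).
Proof.
move=> mf B mB; rewrite -measurable_subalgebraE -[X in measurable X]setTI.
exact: mf.
Qed.

Lemma measurable_wrtS d' (U : measurableType d') (H : set (set T))
    (f : T -> U) :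
  sigma_algebra [set: T] H -> G `<=` H ->
  measurable_wrt G f -> measurable_wrt H f.
Proof.
move=> sH GH mf _ B mB; rewrite setTI.
rewrite (_ : measurable = H :> set (set (g_sigma_algebraType H))); last first.
  exact: sigma_algebra_id.
exact/GH/measurable_wrt_preimage.
Qed.

Lemma measurable_wrt_measurable d' (U : measurableType d') (f : T -> U) :
  G `<=` measurable -> measurable_wrt G f -> measurable_fun [set: T] f.
Proof.
by move=> Gm mf _ B mB; rewrite setTI; exact/Gm/measurable_wrt_preimage.
Qed.

End sub_sigma_algebra.

Lemma measurable_expeR (R : realType) :
  measurable_fun [set: \bar R] (@expeR R).
Proof.
apply: (measurability _ (ErealGenOInfty.measurableE R)) => //.
move=> _ [_ [a ->] <-]; rewrite setTI.
have [a0|a0] := ltP a 0.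
  rewrite (_ : _ @^-1` _ = [set: \bar R])//; apply/seteqP; split=> // y _ /=.
  by rewrite in_itv/= andbT (lt_le_trans _ (expeR_ge0 y)) ?lte_fin.
have [b ba] : exists b, expeR b = a%:E by apply: expeR_total; rewrite lee_fin.
rewrite (_ : _ @^-1` _ = `]b, +oo[%classic); first exact: emeasurable_itv.
by apply/seteqP; split=> y /=; rewrite !in_itv/= !andbT -ba lte_expeR.
Qed.

(** * The maximal inequality for nonnegative supermartingales *)

Section maximal_inequality.
Local Open Scope ereal_scope.
Context d (T : measurableType d) (R : realType)
  (mu : {measure set T -> \bar R}).
Variables (F : nat -> set (set T)) (M : nat -> T -> \bar R).
Hypothesis HF : filtration F.
Hypothesis mM : forall k, measurable_wrt (F k) (M k).
Hypothesis M0 : forall k w, 0 <= M k w.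
Hypothesis MS : forall k D, F k D ->
  \int[mu]_(w in D) M k.+1 w <= \int[mu]_(w in D) M k w.

Let hit c j n := [set w | exists k, (j <= k <= j + n)%N /\ c%:E <= M k w].

Let M_measurable k : measurable_fun [set: T] (M k).
Proof.
have [sF Fm _] := HF.
exact: (measurable_wrt_measurable (sF k) (@Fm k) (@mM k)).
Qed.

Let level_F k c : F k [set w | c%:E <= M k w].
Proof.
have [sF _ _] := HF.
rewrite (_ : [set _ | _] = M k @^-1` `[c%:E, +oo[%classic).
  by apply: (measurable_wrt_preimage (sF k) (@mM k)); exact: emeasurable_itv.
by apply/seteqP; split=> w /=; rewrite in_itv/= andbT.
Qed.

Lemma hitting_measurable c j n :
  measurable [set w | exists k, (j <= k <= j + n)%N /\ c%:E <= M k w].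
Proof.
have [_ Fm _] := HF.
rewrite (_ : [set _ | _] = \bigcup_(k in [set k | (j <= k <= j + n)%N])
    [set w | c%:E <= M k w]).
  by apply: bigcup_measurable => k _; exact/Fm/level_F.
by apply/seteqP; split=> w [k]; [case=> ik cM|move=> ik cM]; exists k.
Qed.

(** Induction on the length [n] of the time window: on [D `&` E], where [E] is
the event that the level is already reached at time [j], Markov's inequality
applies to [M j]; the rest [D `\` E] belongs to [F j], hence to [F j.+1], where
the induction hypothesis and the supermartingale property apply.  Keeping [D]
general avoids stopping times. *)
Lemma maximal_inequality_from (c : R) n j D : (0 <= c)%R -> F j D ->
  c%:E * mu (D `&` hit c j n) <= \int[mu]_(w in D) M j w.
Proof.
move=> c0.
have [sF Fm FS] := HF.
have mMT := M_measurable.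
have FE k : F k [set w | c%:E <= M k w] by exact: level_F.
have mE k : measurable [set w | c%:E <= M k w] by exact: Fm (FE k).
have mhit i m : measurable (hit c i m) by exact: hitting_measurable.
have markovD k A : measurable A ->
    c%:E * mu (A `&` [set w | c%:E <= M k w]) <=
    \int[mu]_(w in A `&` [set w | c%:E <= M k w]) M k w.
  move=> mA; rewrite -integral_cst; last exact: measurableI.
  apply: ge0_le_integral => //.
  - exact: measurableI.
  - exact: measurable_funTS.
  - by move=> w [].
elim: n j D => [|n IHn] j D FD.
  have -> : hit c j 0 = [set w | c%:E <= M j w].
    apply/seteqP; split=> [w [k []]|w /= cM].
      by rewrite addn0 -eqn_leq => /eqP<-.
    by exists j; rewrite addn0 leqnn.
  apply: (le_trans (markovD _ _ (Fm _ _ FD))).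
  apply: ge0_subset_integral => //; first exact/measurableI/mE/Fm/FD.
  exact: Fm FD.
  exact: measurable_funTS.
pose E := [set w | c%:E <= M j w].
have FDE : F j (D `\` E).
  move: (FE j) FD; rewrite -/E -(measurable_subalgebraE (sF j)) => mE' mD'.
  exact: measurableD.
have mD := Fm _ _ FD.
have mEj : measurable E := mE j.
have -> : D `&` hit c j n.+1 = (D `&` E) `|` ((D `\` E) `&` hit c j.+1 n).
  apply/seteqP; split => w.
    move=> [Dw [k [/andP[]]]]; rewrite leq_eqVlt => /predU1P[<- _ cM|jk kn cM].
      by left.
    have [Ew|nEw] := pselect (E w); first by left.
    by right; split=> //; exists k; rewrite jk addSnnS.
  move=> [[Dw Ew]|[[Dw nEw] [k [/andP[jk kn] cM]]]]; split=> //.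
    by exists j; rewrite leqnn leq_addr.
  by exists k; rewrite (ltnW jk) -addSnnS.
rewrite measureU//; last 3 first.
- exact: measurableI.
- by apply: measurableI => //; exact: measurableD.
- by apply/seteqP; split=> // w [[_ Ew] [[_]]].
rewrite ge0_muleDr//.
rewrite -[in leRHS](setUIDK D E) ge0_integral_setU//.
- apply: leeD; first exact: markovD.
  apply: (le_trans (IHn j.+1 _ _)); first exact: FS.
  exact: MS.
- exact: measurableI.
- exact: measurableD.
- exact: measurable_funTS.
- apply/disj_setPS; by move=> w [[_ Ew] [_]].
Qed.

Lemma maximal_inequality (c : R) n : (0 <= c)%R ->
  c%:E * mu [set w | exists k, (0 <= k <= n)%N /\ c%:E <= M k w] <=
  \int[mu]_w M 0%N w.
Proof.
have [sF _ _] := HF.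
move=> c0; rewrite -[X in mu X]setTI -[n]add0n.
apply: maximal_inequality_from => //.
by rewrite -(measurable_subalgebraE (sF 0%N)); exact: measurableT.
Qed.

End maximal_inequality.

(** * Integral inequalities weighted by a measurable function *)

Import HBNNSimple.

Section integral_mul_wrt.
Local Open Scope ereal_scope.
Context d (T : measurableType d) (R : realType)
  (mu : {measure set T -> \bar R}).
Variable G : set (set T).
Hypotheses (sG : sigma_algebra [set: T] G) (Gm : G `<=` measurable).

Lemma integral_mul_nnsfun (h : {nnsfun (g_sigma_algebraType G) >-> R})
    (f : T -> \bar R) : (forall w, 0 <= f w) -> measurable_fun [set: T] f ->
  \int[mu]_w ((h w)%:E * f w) =
  \sum_(r \in range h) r%:E * \int[mu]_(w in h @^-1` [set r]) f w.
Proof.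
move=> f0 mf.
have mh r : measurable (h @^-1` [set r] : set T).
  by apply/Gm/(measurable_wrt_preimage sG (measurable_funPT h)).
transitivity (\int[mu]_w \sum_(r \in range h)
    ((r * \1_(h @^-1` [set r]) w)%:E * f w)).
  apply: eq_integral => w _.
  rewrite -ge0_mule_fsuml; last by move=> y; exact: nnfun_muleindic_ge0.
  by rewrite fsumEFin // -(fimfunE h w).
rewrite ge0_integral_fsum//; last 2 first.
- move=> r; apply: emeasurable_funM => //; apply/measurable_EFinP.
  by apply: measurable_funM => //; exact: measurable_indic.
- by move=> r w _; rewrite mule_ge0 ?f0// nnfun_muleindic_ge0.
apply: eq_fsbigr => r; rewrite inE => -[w _ hw].
have r0 : (0 <= r)%R by rewrite -hw.
under eq_integral do rewrite EFinM -muleA.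
rewrite ge0_integralZl ?lee_fin//.
- congr (_ * _); rewrite [RHS]integral_mkcond; apply: eq_integral => t _.
  by rewrite muleC epatch_indic.
- apply: emeasurable_funM => //; apply/measurable_EFinP.
  exact: measurable_indic.
- by move=> t _; rewrite mule_ge0 ?lee_fin.
Qed.

(** Approximate [phi] from below by simple functions [h n] measurable for [G]:
for these, the inequality is a nonnegative combination of the hypothesis on
the level sets.  On the left one passes to the limit by monotone convergence,
where finiteness of [f1] gives [h n * f1 --> phi * f1] pointwise; on the right
[h n <= phi] suffices, so [f2] may take the value [+oo]. *)
Lemma le_integral_mul_wrt (f1 : T -> R) (f2 phi : T -> \bar R) :
  (forall w, 0 <= f1 w)%R -> (forall w, 0 <= f2 w) ->
  measurable_fun [set: T] f1 -> measurable_fun [set: T] f2 ->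
  (forall A, G A -> \int[mu]_(w in A) (f1 w)%:E <= \int[mu]_(w in A) f2 w) ->
  (forall w, 0 <= phi w) -> measurable_wrt G phi ->
  \int[mu]_w (phi w * (f1 w)%:E) <= \int[mu]_w (phi w * f2 w).
Proof.
move=> f10 f20 mf1 mf2 f12 phi0 mphi.
have mphiT : measurable_fun [set: T] phi.
  exact: (measurable_wrt_measurable sG Gm mphi).
pose h := nnsfun_approx measurableT mphi.
have h_cvg w : (EFin \o h^~ w) @ \oo --> phi w.
  exact: (@cvg_nnsfun_approx _ _ _ _ _ _ mphi (fun w _ => phi0 w)).
have h_nd w m k : (m <= k)%N -> (h m w <= h k w)%R.
  by move=> mk; exact/lefP/nd_nnsfun_approx.
have h_le w n : (h n w)%:E <= phi w.
  rewrite -(cvg_lim _ (h_cvg w))//.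
  apply: lime_ge; first by apply/cvg_ex; exists (phi w); exact: h_cvg.
  by near=> m; rewrite lee_fin h_nd//; near: m; exists n.
have mf1E : measurable_fun [set: T] (fun w => (f1 w)%:E).
  exact/measurable_EFinP.
have mh n : measurable_fun [set: T] (fun w => (h n w)%:E).
  apply/measurable_EFinP.
  exact: (measurable_wrt_measurable sG Gm (measurable_funPT (h n))).
have -> : \int[mu]_w (phi w * (f1 w)%:E) =
    limn (fun n => \int[mu]_w ((h n w)%:E * (f1 w)%:E)).
  rewrite -monotone_convergence//.
  - apply: eq_integral => w _; apply/esym/cvg_lim => //.
    by apply: cvgeZr => //; exact: h_cvg.
  - by move=> n; exact: emeasurable_funM.
  - by move=> n w _; rewrite mule_ge0 ?lee_fin.
  - by move=> w _ m k mk; rewrite lee_wpmul2r ?lee_fin ?h_nd.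
apply: lime_le.
  apply: ereal_nondecreasing_is_cvgn => m k mk; apply: ge0_le_integral => //.
  - by move=> w _; rewrite mule_ge0 ?lee_fin.
  - exact: emeasurable_funM.
  - exact: emeasurable_funM.
  - by move=> w _; rewrite lee_wpmul2r ?lee_fin ?h_nd.
near=> n.
apply: (@le_trans _ _ (\int[mu]_w ((h n w)%:E * f2 w))).
  rewrite !integral_mul_nnsfun//.
  apply: lee_fsum => // r [w _ hw]; apply: lee_wpmul2l.
    by rewrite -hw lee_fin.
  exact/f12/(measurable_wrt_preimage sG (measurable_funPT (h n))).
apply: ge0_le_integral => //.
- by move=> w _; rewrite mule_ge0 ?lee_fin.
- exact: emeasurable_funM.
- exact: emeasurable_funM.
- by move=> w _; rewrite lee_wpmul2r.
Unshelve. all: by end_near. Qed.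

End integral_mul_wrt.

(** * The conditional exponential moment of a truncated difference *)

Definition truncate (R : realType) (y r : R) : R := if r <= y then r else 0.

Lemma measurable_truncate (R : realType) (y : R) :
  measurable_fun [set: R] (truncate y).
Proof.
apply: measurable_fun_ifT => //.
exact: measurable_fun_ler.
Qed.

(** Coefficient of the quadratic term in [expR_truncate_le]. *)
Definition bernstein_coef (R : realType) (y lam : R) : R :=
  lam ^+ 2 / (2 * (1 - lam * y / 3)).

Lemma bernstein_coef_ge0 (R : realType) (y lam : R) :
  lam * y < 3 -> 0 <= bernstein_coef y lam.
Proof.
move=> ly3; rewrite /bernstein_coef divr_ge0 ?sqr_ge0// mulr_ge0//; lra.
Qed.

(** For [r <= y] this is [expR_Bernstein] at [lam * r <= lam * y]; for [r > y]
the left-hand side is 1 and the right-hand side is at least 1. *)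
Lemma expR_truncate_le (R : realType) (y lam r : R) :
  0 <= y -> 0 <= lam -> lam * y < 3 ->
  expR (lam * truncate y r) <= 1 + lam * r + bernstein_coef y lam * r ^+ 2.
Proof.
move=> y0 lam0 ly3; rewrite /truncate; case: ifPn => [ry|].
  have := @expR_Bernstein R (lam * r) (lam * y) (ler_wpM2l lam0 ry) ly3.
  by rewrite exprMn /bernstein_coef mulrAC.
rewrite -ltNge => yr; rewrite mulr0 expR0 -addrA lerDl.
have r0 : 0 <= r by lra.
by apply: addr_ge0; apply: mulr_ge0; rewrite ?sqr_ge0// bernstein_coef_ge0.
Qed.

Section conditional_expectation.
Local Open Scope ereal_scope.
Context d (T : measurableType d) (R : realType) (P : probability T R).
Variable G : set (set T).
Hypotheses (sG : sigma_algebra [set: T] G) (Gm : G `<=` measurable).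

(** The set where [g] is negative belongs to [G], so the integral of [g] over
it equals that of [f] and is nonnegative. *)
Lemma cond_exp_ge0_lt0 (f g : T -> \bar R) :
  (forall w, 0 <= f w) -> is_cond_exp P G f g -> P [set w | g w < 0] = 0.
Proof.
move=> f0 [mg fg].
have mgT := measurable_wrt_measurable sG Gm mg.
pose A := [set w | g w < 0].
have GA : G A.
  rewrite (_ : A = g @^-1` `]-oo, 0[%classic).
    by apply: (measurable_wrt_preimage sG mg); exact: emeasurable_itv.
  by apply/seteqP; split=> w /=; rewrite in_itv.
have mA := Gm GA.
have : \int[P]_(w in A) `|g w| = 0.
  apply/eqP; rewrite eq_le integral_ge0// andbT.
  rewrite (eq_integral (fun w => - g w)); last first.
    by move=> w; rewrite inE => /ltW gw; rewrite lee0_abs.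
  rewrite -leeN2 oppe0 -integral_ge0N; last first.
    by move=> w /ltW gw; rewrite oppe_ge0.
  rewrite (eq_integral g); last by move=> w _; rewrite oppeK.
  by rewrite fg// integral_ge0.
move/(ae_eq_integral_abs P mA (measurable_funTS mgT)) => [N [mN PN sN]].
apply: (subset_measure0 (B := N)) => //.
by move=> w Aw; apply: sN => /= /(_ Aw) gw; move: Aw; rewrite /A/= gw ltxx.
Qed.

(** This is E(exp(lam * truncate y X) | G) <= 1 + g E(X^2 | G), tested on the
sets of [G].  Integrate [expR_truncate_le] with [X] split as [X^+ - X^-], so
that all integrands are nonnegative: the integral of [X^+] over [A] is at most
that of [X^-], which is finite and cancels. *)
Lemma integral_expR_truncate_le (X : T -> R) (Y V : T -> \bar R) (y lam : R) A :
  (0 <= y)%R -> (0 <= lam)%R -> (lam * y < 3)%R ->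
  P.-integrable [set: T] (EFin \o X) ->
  is_cond_exp P G (EFin \o X) Y -> {ae P, forall w, Y w <= 0} ->
  is_cond_exp P G (fun w => ((X w) ^+ 2)%:E) V -> G A ->
  \int[P]_(w in A) (expR (lam * truncate y (X w)))%:E <=
  \int[P]_(w in A) (1 + (bernstein_coef y lam)%:E * V^\+ w).
Proof.
move=> y0 lam0 ly3 iX [mY XY] Y0 [mV XV] GA; set g := bernstein_coef y lam.
have g0 : (0 <= g)%R by exact: bernstein_coef_ge0.
have mA := Gm GA.
have mX : measurable_fun [set: T] X.
  by apply/measurable_EFinP/(measurable_int P).
have mVT := measurable_wrt_measurable sG Gm mV.
have mYT := measurable_wrt_measurable sG Gm mY.
have mXp : measurable_fun A (EFin \o X)^\+.
  by apply: measurable_funTS; exact/measurable_funepos/measurable_EFinP.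
have mXn : measurable_fun A (EFin \o X)^\-.
  by apply: measurable_funTS; exact/measurable_funeneg/measurable_EFinP.
have mX2 : measurable_fun A (fun w => (X w ^+ 2)%:E).
  by apply: measurable_funTS; apply/measurable_EFinP; exact: measurable_funX.
have mVp : measurable_fun A V^\+.
  by apply: measurable_funTS; exact: measurable_funepos.
have mexp : measurable_fun A (fun w => (expR (lam * truncate y (X w)))%:E).
  apply: measurable_funTS; apply/measurable_EFinP.
  apply: (measurableT_comp (@measurable_expR R)); apply: measurable_funM => //.
  exact: measurableT_comp (measurable_truncate y) mX.
have mcM (c : R) (f : T -> \bar R) : measurable_fun A f ->
    measurable_fun A (fun w => c%:E * f w).
  by move=> mf; exact: emeasurable_funM.
have iXA : P.-integrable A (EFin \o X) by exact: integrableS iX.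
have fXn : \int[P]_(w in A) (EFin \o X)^\- w \is a fin_num.
  by apply: integrable_fin_num => //; exact: integrable_funeneg.
have X_le : \int[P]_(w in A) (EFin \o X)^\+ w <=
            \int[P]_(w in A) (EFin \o X)^\- w.
  rewrite -sube_le0 -integralE -XY// integralE.
  rewrite (_ : \int[P]_(w in A) Y^\+ w = 0).
    by rewrite sub0e leeNl oppe0 integral_ge0.
  rewrite (ae_eq_integral (cst 0))//.
  - exact: integral0.
  - by apply: measurable_funTS; exact: measurable_funepos.
  - by apply: filterS Y0 => w Yw _; rewrite /= funeposE; exact/max_idPr.
have V_le : \int[P]_(w in A) (X w ^+ 2)%:E <= \int[P]_(w in A) V^\+ w.
  by rewrite -XV// integralE geeDl// leeNl oppe0 integral_ge0.
have lXn0 w : 0 <= lam%:E * (EFin \o X)^\- w by rewrite mule_ge0 ?lee_fin.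
have lXp0 w : 0 <= lam%:E * (EFin \o X)^\+ w by rewrite mule_ge0 ?lee_fin.
(* [lam * X^-] is moved to the left to keep both sides nonnegative. *)
have key : \int[P]_(w in A) ((expR (lam * truncate y (X w)))%:E +
      lam%:E * (EFin \o X)^\- w) <=
    \int[P]_(w in A) ((1 + lam%:E * (EFin \o X)^\+ w) + g%:E * (X w ^+ 2)%:E).
  apply: ge0_le_integral => //.
  - by move=> w _; rewrite adde_ge0 ?lee_fin ?expR_ge0.
  - by apply: emeasurable_funD => //; exact: mcM.
  - apply: emeasurable_funD; last exact: mcM.
    by apply: emeasurable_funD => //; exact: mcM.
  - move=> w _; rewrite funeposE funenegE/= -!EFin_max.
    rewrite -!EFinM -!EFinD lee_fin.
    have := expR_truncate_le (X w) y0 lam0 ly3; rewrite -/g.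
    have [Xw|Xw] := leP 0%R (X w).
      rewrite (_ : Num.max (- X w) 0 = 0)%R; last first.
        by apply/max_idPr; rewrite oppr_le0.
      lra.
    rewrite (_ : Num.max (- X w) 0 = - X w)%R; last first.
      by apply/max_idPl; rewrite oppr_ge0 ltW.
    lra.
have lfin : lam%:E * \int[P]_(w in A) (EFin \o X)^\- w \is a fin_num.
  by rewrite fin_numM.
rewrite -(leeD2rE _ _ lfin).
have intD (f1 f2 : T -> \bar R) :
    (forall w, 0 <= f1 w) -> (forall w, 0 <= f2 w) ->
    measurable_fun A f1 -> measurable_fun A f2 ->
    \int[P]_(w in A) (f1 w + f2 w) =
    \int[P]_(w in A) f1 w + \int[P]_(w in A) f2 w.
  by move=> f10 f20 mf1 mf2; rewrite ge0_integralD.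
have intZ (c : R) (f : T -> \bar R) :
    (0 <= c)%R -> (forall w, 0 <= f w) -> measurable_fun A f ->
    \int[P]_(w in A) (c%:E * f w) = c%:E * \int[P]_(w in A) f w.
  by move=> c0 f0 mf; rewrite ge0_integralZl// lee_fin.
have X20 w : 0 <= (X w ^+ 2)%:E by rewrite lee_fin sqr_ge0.
have exp0 w : 0 <= (expR (lam * truncate y (X w)))%:E.
  by rewrite lee_fin expR_ge0.
have gX20 w : 0 <= g%:E * (X w ^+ 2)%:E by rewrite mule_ge0.
have gV0 w : 0 <= g%:E * V^\+ w by rewrite mule_ge0.
have XP0 w : 0 <= 1 + lam%:E * (EFin \o X)^\+ w by rewrite adde_ge0.
have m1X : measurable_fun A (fun w => 1 + lam%:E * (EFin \o X)^\+ w).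
  by apply: emeasurable_funD => //; exact: mcM.
move: key; rewrite (intD _ _ exp0 lXn0 mexp (mcM _ _ mXn)).
rewrite (intD _ _ XP0 gX20 m1X (mcM _ _ mX2)).
rewrite (intD (cst 1) _ _ lXp0 _ (mcM _ _ mXp))//.
rewrite (intD (cst 1) _ _ gV0 _ (mcM _ _ mVp))//.
rewrite !intZ// => /le_trans; apply.
rewrite [leLHS]addeAC; apply: leeD; last by rewrite lee_wpmul2l ?lee_fin.
by apply: leeD => //; rewrite lee_wpmul2l ?lee_fin.
Qed.

End conditional_expectation.

(** * The exponential supermartingale *)

Section exponential_supermartingale.
Local Open Scope ereal_scope.
Context d (T : measurableType d) (R : realType) (P : probability T R).
Variables (F : nat -> set (set T)) (X : nat -> T -> R) (V : nat -> T -> \bar R).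
Hypothesis HX : supermartingale_differences P F X.
Hypothesis HV : forall i, (1 <= i)%N ->
  is_cond_exp P (F i.-1) (fun w => ((X i w) ^+ 2)%:E) (V i).
Variables (y lam : R).
Hypotheses (y0 : (0 <= y)%R) (lam0 : (0 <= lam)%R) (ly3 : (lam * y < 3)%R).

Let g := bernstein_coef y lam.

(** With positive parts the sum of the [V i] is never an indeterminate form, and
the exponent is at worst [-oo], where the process vanishes. *)
Definition exp_process k w :=
  expeR ((lam * \sum_(1 <= i < k.+1) truncate y (X i w))%:E
         - (bernstein_coef y lam)%:E * \sum_(1 <= i < k.+1) (V i)^\+ w).

Lemma exp_process0 w : exp_process 0 w = 1.
Proof. by rewrite /exp_process !big_geq// mulr0 mule0 sube0 expeR0. Qed.

Lemma exp_processS k w : exp_process k.+1 w =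
  exp_process k w * expeR (- (g%:E * (V k.+1)^\+ w)) *
  (expR (lam * truncate y (X k.+1 w)))%:E.
Proof.
rewrite /exp_process -/g big_nat_recr//= [in X in _ - X]big_nat_recr//=.
have g0 : (0 <= g)%R by exact: bernstein_coef_ge0.
have W0 : 0 <= \sum_(1 <= i < k.+1) (V i)^\+ w by exact: sume_ge0.
rewrite (ge0_muleDr _ W0)// oppeD; last first.
  by rewrite ge0_adde_def// inE mule_ge0.
rewrite (_ : (expR _)%:E = expeR (lam * truncate y (X k.+1 w))%:E)//.
rewrite -!expeRD mulrDr EFinD; congr expeR.
by rewrite addeACA [X in _ + X]addeC addeA.
Qed.

Lemma exp_process_measurable k : measurable_wrt (F k) (exp_process k).
Proof.
have [[sF Fm FS] HX'] := HX.
elim: k => [|k IHk].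
  have -> : exp_process 0 = cst 1 by rewrite funeqE => w; rewrite exp_process0.
  exact: measurable_cst.
rewrite (_ : exp_process k.+1 = (fun w =>
    exp_process k w * expeR (- (g%:E * (V k.+1)^\+ w)) *
    (expR (lam * truncate y (X k.+1 w)))%:E)); last first.
  by rewrite funeqE => w; rewrite exp_processS.
have [mX _ _] := HX' k.+1 isT.
have [mV _] := HV (isT : (1 <= k.+1)%N).
apply: emeasurable_funM.
  apply: (measurable_wrtS (sF k) (sF k.+1) (@FS k)).
  apply: emeasurable_funM => //.
  apply: (measurableT_comp (@measurable_expeR R)).
  apply: (measurableT_comp (@oppe_measurable R setT)).
  apply: emeasurable_funM => //.
  exact: measurable_funepos.
apply/measurable_EFinP/(measurableT_comp (@measurable_expR R)).
apply: measurable_funM => //.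
exact: (measurableT_comp (measurable_truncate y) mX).
Qed.

(** Apply [le_integral_mul_wrt] to the comparison
[integral_expR_truncate_le] with the [F k]-measurable weight
[exp_process k * exp(- g V^+) * 1_D], then use [1 + u <= exp u] with
[u = g V^+]. *)
Lemma exp_process_supermartingale k D : F k D ->
  \int[P]_(w in D) exp_process k.+1 w <= \int[P]_(w in D) exp_process k w.
Proof.
move=> FD.
have [[sF Fm FS] HX'] := HX.
have [mX iX [Y [XY Y0]]] := HX' k.+1 isT.
have XV := HV (isT : (1 <= k.+1)%N); have [mV _] := XV.
have g0 : (0 <= g)%R by exact: bernstein_coef_ge0.
have mXT := measurable_wrt_measurable (sF k.+1) (@Fm k.+1) mX.
have mVT := measurable_wrt_measurable (sF k) (@Fm k) mV.
have mM := @exp_process_measurable k.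
have mMT := measurable_wrt_measurable (sF k) (@Fm k) mM.
pose h w := expeR (- (g%:E * (V k.+1)^\+ w)).
have h0 w : 0 <= h w by exact: expeR_ge0.
have M0 w : 0 <= exp_process k w by exact: expeR_ge0.
have mD : measurable (D : set (g_sigma_algebraType (F k))).
  by rewrite (measurable_subalgebraE (sF k)).
pose phi w := exp_process k w * h w * (\1_D w)%:E.
have mphi : measurable_wrt (F k) phi.
  apply: emeasurable_funM; last first.
    by apply/measurable_EFinP; exact: measurable_indic.
  apply: emeasurable_funM => //.
  apply: (measurableT_comp (@measurable_expeR R)).
  apply: (measurableT_comp (@oppe_measurable R setT)).
  by apply: emeasurable_funM => //; exact: measurable_funepos.
have phi0 w : 0 <= phi w by rewrite /phi !mule_ge0// lee_fin.
have mphiT := measurable_wrt_measurable (sF k) (@Fm k) mphi.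
have -> : \int[P]_(w in D) exp_process k.+1 w =
    \int[P]_w (phi w * (expR (lam * truncate y (X k.+1 w)))%:E).
  rewrite integral_mkcond; apply: eq_integral => w _.
  by rewrite epatch_indic/= exp_processS /phi /h muleAC.
have g1V0 w : 0 <= 1 + g%:E * (V k.+1)^\+ w.
  by rewrite adde_ge0 ?mule_ge0 ?lee_fin.
have m1V : measurable_fun [set: T] (fun w => 1 + g%:E * (V k.+1)^\+ w).
  apply: emeasurable_funD => //; apply: emeasurable_funM => //.
  exact: measurable_funepos.
apply: (@le_trans _ _ (\int[P]_w (phi w * (1 + g%:E * (V k.+1)^\+ w)))).
  apply: (le_integral_mul_wrt (sF k) (@Fm k)) => //.
  - apply: (measurableT_comp (@measurable_expR R)).
    apply: measurable_funM => //.
    exact: (measurableT_comp (measurable_truncate y) mXT).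
  - move=> A FA.
    exact: (integral_expR_truncate_le (sF k) (@Fm k)) iX XY Y0 XV FA.
rewrite [leRHS]integral_mkcond; apply: ge0_le_integral => //.
- by move=> w _; rewrite mule_ge0.
- exact: emeasurable_funM.
- rewrite epatch_indic; apply: emeasurable_funM => //.
  by apply/measurable_EFinP; apply: measurable_indic; exact: Fm FD.
move=> w _; rewrite epatch_indic/= /phi.
rewrite [X in X * _]muleAC -[leLHS]muleA -[leRHS]mule1.
apply: lee_wpmul2l; first by rewrite mule_ge0 ?lee_fin.
apply: (@le_trans _ _ (h w * expeR (g%:E * (V k.+1)^\+ w))).
  by rewrite lee_wpmul2l// expeR_ge1Dx.
rewrite -expeRD -[leRHS](@expeR0 R) lee_expeR addeC.
(* For [u = +oo] the sum [u - u] is [-oo], and the bound still holds. *)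
case: (g%:E * _) => [r| |]; first by rewrite /= -EFinD subrr.
  exact: leNye.
exact: leNye.
Qed.

Lemma exp_process_ge0 k w : 0 <= exp_process k w.
Proof. exact: expeR_ge0. Qed.

End exponential_supermartingale.

(** * Freedman's inequality for truncated differences *)

Section Freedman.
Context d (T : measurableType d) (R : realType) (P : probability T R).
Variables (F : nat -> set (set T)) (X : nat -> T -> R) (V : nat -> T -> \bar R).
Hypothesis HX : supermartingale_differences P F X.
Hypothesis HV : forall i, (1 <= i)%N ->
  is_cond_exp P (F i.-1) (fun w => ((X i w) ^+ 2)%:E) (V i).

Lemma differences_measurable i : (1 <= i)%N -> measurable_fun [set: T] (X i).
Proof.
have [[sF Fm _] HX'] := HX.
by move=> /HX'[mX _ _]; exact: (measurable_wrt_measurable (sF i) (@Fm i) mX).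
Qed.

Lemma variances_measurable i : (1 <= i)%N -> measurable_fun [set: T] (V i).
Proof.
have [[sF Fm _] _] := HX.
move=> /HV[mV _].
exact: (measurable_wrt_measurable (sF i.-1) (@Fm i.-1) mV).
Qed.

(** Stated for transformed [X i] and [V i], so as to cover both the event of the
theorem ([f] and [h] are identities) and its truncated version. *)
Lemma crossing_measurable (f : R -> R) (h : \bar R -> \bar R) (x c : R) n :
  measurable_fun [set: R] f -> measurable_fun [set: \bar R] h ->
  measurable [set w | exists k : nat,
        [/\ (1 <= k <= n)%N,
            x <= \sum_(1 <= i < k.+1) f (X i w) &
            (\sum_(1 <= i < k.+1) h (V i w) <= c%:E)%E]].
Proof.
move=> mf mh.
rewrite (_ : [set _ | _] = \bigcup_(k in [set k | (1 <= k <= n)%N])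
    ([set: T] `&` [set w | x <= \sum_(1 <= i < k.+1) f (X i w)] `&`
     ([set: T] `&`
      [set w | (\sum_(1 <= i < k.+1) h (V i w) <= c%:E)%E]))); last first.
  apply/seteqP; split=> w.
    by move=> [k [kn xS Vc]]; exists k.
  by move=> [k kn [[_ xS] [_ Vc]]]; exists k.
apply: bigcup_measurable => k _; apply: measurableI.
  apply: measurable_fun_le => //.
  rewrite (_ : (fun w => _) = (fun w => \sum_(0 <= i < k) f (X i.+1 w))).
    apply: measurable_sum => i.
    by apply: (measurableT_comp mf); exact: differences_measurable.
  by apply/funext => w; rewrite big_add1.
apply: emeasurable_fun_infty_c => //.
rewrite (_ : (fun w => _) = (fun w => \sum_(0 <= i < k) h (V i.+1 w))%E).
  apply: emeasurable_sum => i.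
  by apply: (measurableT_comp mh); exact: variances_measurable.
by apply/funext => w; rewrite big_add1.
Qed.

(** On the event, some [exp_process k] with [k <= n] is at least
[c = exp(lam x - g v^2)]; the maximal inequality bounds the probability of this
by [1 / c].  For [lam = x / q] one has [1 - lam y / 3 = v^2 / q], hence
[g v^2 = lam x / 2] and [c = exp(x^2 / (2 q))]. *)
Lemma Freedman_truncated (y x v : R) n : 0 < y -> 0 < x -> 0 < v ->
  (P [set w | exists k : nat,
        [/\ (1 <= k <= n)%N,
            x <= \sum_(1 <= i < k.+1) truncate y (X i w) &
            (\sum_(1 <= i < k.+1) maxe (V i w) 0 <= (v ^+ 2)%:E)%E]%R]
   <= (expR (- (x ^+ 2 / (2 * (v ^+ 2 + 3^-1 * (x * y))))))%:E)%E.
Proof.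
move=> y0 x0 v0; have [sF _ _] := HX.1.
pose q := v ^+ 2 + 3^-1 * (x * y).
have xy0 : 0 < x * y by exact: mulr_gt0.
have v20 : 0 < v ^+ 2 by exact: exprn_gt0.
have q0 : 0 < q by rewrite /q; lra.
pose lam := x / q.
have lam0 : 0 < lam by exact: divr_gt0.
have ly3 : lam * y < 3 by rewrite /lam mulrAC ltr_pdivrMr// /q; lra.
have gE : bernstein_coef y lam = lam * x / (2 * v ^+ 2).
  rewrite /bernstein_coef (_ : 1 - lam * y / 3 = v ^+ 2 / q).
    by rewrite /lam; field; rewrite !gt_eqF.
  have -> : v ^+ 2 = q - 3^-1 * (x * y) by rewrite /q; ring.
  by rewrite /lam; field; rewrite gt_eqF.
pose g := bernstein_coef y lam.
have g0 : 0 <= g by rewrite bernstein_coef_ge0.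
pose c := expR (lam * x - g * v ^+ 2).
have cE : c^-1 = expR (- (x ^+ 2 / (2 * q))).
  rewrite -expRN; congr expR; rewrite /g gE /lam; field.
  by rewrite !gt_eqF.
pose M := exp_process X V y lam.
have mM k : measurable_wrt (F k) (M k).
  exact: (exp_process_measurable HX HV ly3).
have MS k D : F k D -> (\int[P]_(w in D) M k.+1 w <= \int[P]_(w in D) M k w)%E.
  exact: (exp_process_supermartingale HX HV (ltW y0) (ltW lam0) ly3).
have M0 k w : (0 <= M k w)%E by exact: exp_process_ge0.
have max_le := maximal_inequality HX.1 mM M0 MS n (expR_ge0 _ : 0 <= c).
have mhit : measurable [set w | exists k, (0 <= k <= n)%N /\ (c%:E <= M k w)%E].
  exact: (hitting_measurable HX.1 mM c 0%N n).
rewrite -/q -cE -[leRHS]mule1 lee_pdivlMl ?expR_gt0//.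
apply: (@le_trans _ _ (\int[P]_w M 0%N w)%E); last first.
  rewrite (eq_integral (cst 1%E)); last by move=> w _; rewrite /M exp_process0.
  by rewrite integral_cst// mul1e; exact: probability_le1.
apply: (le_trans _ max_le); apply: lee_wpmul2l.
  by rewrite lee_fin expR_ge0.
apply: le_measure; rewrite ?inE//.
  apply: (@crossing_measurable (truncate y) (maxe^~ 0%E)).
    exact: measurable_truncate.
  exact: measurable_maxe.
move=> w [k [/andP[_ kn] xS Vv]]; exists k; split; first by rewrite leq0n.
rewrite /M /exp_process /c -[leLHS]/(expeR (lam * x - g * v ^+ 2)%:E).
rewrite lee_expeR EFinB.
apply: leeB; first by rewrite lee_fin ler_pM2l.
rewrite [leRHS]EFinM; apply: lee_wpmul2l; first by rewrite lee_fin.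
by rewrite (eq_bigr (fun i => maxe (V i w) 0%E))// => i _; rewrite funeposE.
Qed.

End Freedman.

(** * Tails of the differences and the main inequality *)

Lemma measurable_gt d (T : measurableType d) (R : realType) (X : T -> R)
    (y : R) :
  measurable_fun [set: T] X -> measurable [set w | y < X w].
Proof.
move=> mX; rewrite (_ : [set _ | _] = [set: T] `&` X @^-1` `]y, +oo[%classic).
  exact: mX.
by rewrite setTI; apply/seteqP; split=> w /=; rewrite in_itv/= andbT.
Qed.

Lemma exp_moment_tail d (T : measurableType d) (R : realType)
    (P : probability T R) (X : T -> R) (p C y : R) :
  measurable_fun [set: T] X -> 0 <= p -> 0 <= y ->
  ('E_P[fun w => expR (Num.max (X w) 0 `^ p)%R] <= C%:E)%E ->
  (P [set w | (y < X w)%R] <= (C * expR (- (y `^ p)))%:E)%E.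
Proof.
move=> mX p0 y0 EC.
have mA : measurable [set w | y < X w] by exact: measurable_gt.
have mf : measurable_fun [set: T] (fun w => (expR (Num.max (X w) 0 `^ p))%:E).
  apply/measurable_EFinP/(measurableT_comp (@measurable_expR R)).
  apply: (measurableT_comp (measurable_powR p)).
  exact: measurable_maxr.
rewrite mulrC EFinM expRN lee_pdivlMl ?expR_gt0//; apply: le_trans EC.
rewrite [in leRHS]unlock -(integral_cst P mA).
apply: (@le_trans _ _
    (\int[P]_(w in [set w | (y < X w)%R]) (expR (Num.max (X w) 0 `^ p))%:E)%E).
  apply: ge0_le_integral => //.
  - by move=> w _; rewrite lee_fin expR_ge0.
  - exact: measurable_funTS.
  - move=> w /= /ltW yX; rewrite lee_fin ler_expR.
    by apply: ge0_ler_powR; rewrite ?nnegrE// le_max ?yX ?lexx ?orbT.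
by apply: ge0_subset_integral => // w _; rewrite lee_fin expR_ge0.
Qed.

Unset Implicit Arguments.

(* [V i] is an arbitrary version of E(X_i ^ 2 | F_(i-1)). *)
Theorem theorem2p2 (d : measure_display) (T : measurableType d) (R : realType)
    (P : probability T R) (alpha C1 : R)
    (F : nat -> set (set T)) (X : nat -> T -> R) (V : nat -> T -> \bar R)
    (alpha_gt0 : 0 < alpha) (alpha_lt1 : alpha < 1) (C1_gt0 : 0 < C1)
    (HX : supermartingale_differences P F X)
    (HV : forall i, (1 <= i)%N ->
      is_cond_exp P (F i.-1) (fun w => ((X i w) ^+ 2)%:E) (V i))
    (Hsup : (ereal_sup
      [set 'E_P[fun w => expR (Num.max (X i w) 0 `^ (alpha / (1 - alpha)))%R]
        | i in [set i | (1 <= i)%N]] <= C1%:E)%E)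
    (x v : R) (x_gt0 : 0 < x) (v_gt0 : 0 < v) (n : nat) (n_ge1 : (1 <= n)%N) :
  (P [set w | exists k : nat,
        [/\ (1 <= k <= n)%N,
            x <= \sum_(1 <= i < k.+1) X i w &
            (\sum_(1 <= i < k.+1) V i w <= (v ^+ 2)%:E)%E]%R]
   <= (expR (- (x ^+ 2 / (2 * (v ^+ 2 + 3^-1 * x `^ (2 - alpha)))))
       + n%:R * C1 * expR (- (x `^ alpha)))%:E)%E.
Proof.
have a1 : 0 < 1 - alpha by rewrite subr_gt0.
pose y := x `^ (1 - alpha).
have y0 : 0 < y by rewrite powR_gt0.
have xyE : x `^ (2 - alpha) = x * y.
  have -> : 2 - alpha = 1 + (1 - alpha) by ring.
  by rewrite powRD ?powRr1 ?(ltW x_gt0)// (gt_eqF x_gt0) implybT.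
have yE : y `^ (alpha / (1 - alpha)) = x `^ alpha.
  by rewrite -powRrM mulrC divfK// gt_eqF.
have [[sF Fm _] _] := HX.
have mX i : measurable_fun [set: T] (X i.+1)
  by exact: (differences_measurable HX).
have mV i : measurable_fun [set: T] (V i.+1).
  exact: (variances_measurable HX HV).
(* Outside the events [big i] truncation changes nothing; outside the null
   events [neg i] taking the positive part of the [V i] changes nothing. *)
pose big i := [set w | y < X i.+1 w].
pose neg i := [set w | (V i.+1 w < 0)%E].
have mbig i : measurable (big i) by exact: measurable_gt.
have mneg i : measurable (neg i).
  by rewrite -[X in measurable X]setTI; exact: emeasurable_fun_infty_o.
have mbad i : measurable (big i `|` neg i) by exact: measurableU.
have bad_le i : (P (big i `|` neg i) <= (C1 * expR (- (x `^ alpha)))%:E)%E.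
  have neg_le0 : (P (neg i) <= 0)%E.
    rewrite le_eqVlt; apply/orP; left; apply/eqP.
    apply: (cond_exp_ge0_lt0 (sF i) (@Fm i) _ (HV i.+1 isT)).
    by move=> w; rewrite lee_fin sqr_ge0.
  apply: (le_trans (measureU2 P (mbig i) (mneg i))).
  rewrite -[leRHS]adde0; apply: leeD; last exact: neg_le0.
  rewrite -yE; apply: exp_moment_tail => //.
  - by rewrite divr_ge0// ltW.
  - exact: ltW.
  - by apply: le_trans Hsup; apply: ereal_sup_ubound; exists i.+1.
set A := [set w | _].
pose B := [set w | exists k : nat,
        [/\ (1 <= k <= n)%N,
            x <= \sum_(1 <= i < k.+1) truncate y (X i w) &
            (\sum_(1 <= i < k.+1) maxe (V i w) 0 <= (v ^+ 2)%:E)%E]%R].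
have mA : measurable A.
  exact: (@crossing_measurable _ _ _ _ _ _ _ HX HV id id).
have mB : measurable B.
  apply: (@crossing_measurable _ _ _ _ _ _ _ HX HV (truncate y) (maxe^~ 0%E)).
    exact: measurable_truncate.
  exact: measurable_maxe.
pose bad := \big[setU/set0]_(i < n) (big i `|` neg i).
have mbads : measurable bad by exact: bigsetU_measurable.
have AB : A `<=` B `|` bad.
  move=> w [k [/andP[k1 kn] xS Vv]].
  have [|nbad] := pselect (bad w); first by right.
  have good i : (1 <= i < k.+1)%N -> X i w <= y /\ (0 <= V i w)%E.
    move=> /andP[i1 ik].
    have : ~ (big i.-1 `|` neg i.-1) w.
      move=> bi; apply: nbad.
      rewrite /bad -(bigcup_mkord n (fun i => big i `|` neg i)).
      by exists i.-1 => //=; rewrite prednK// (leq_trans _ kn).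
    by move=> /not_orP[]; rewrite /big /neg /= prednK// => /negP + /negP;
      rewrite -!leNgt.
  left; exists k; split; first by rewrite k1.
  - rewrite (eq_big_nat _ _ (F2 := fun i => X i w))// => i /good[Xy _].
    by rewrite /truncate Xy.
  - rewrite (eq_big_nat _ _ (F2 := fun i => V i w))// => i /good[_ V0].
    exact/max_idPl.
apply: (@le_trans _ _ (P (B `|` bad))).
  by apply: le_measure; rewrite ?inE//; exact: measurableU.
apply: (le_trans (measureU2 P mB mbads)).
rewrite EFinD xyE; apply: leeD; first exact: (Freedman_truncated HX HV).
apply: (@le_trans _ _ (\sum_(i < n) P (big i `|` neg i))%E).
  exact: (Boole_inequality P (fun i _ => mbad i)).
rewrite -mulrA mulr_natl -[X in _ *+ X](card_ord n) -sumr_const.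
by rewrite -sumEFin; apply: lee_sum => i _; exact: bad_le.
Qed.
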